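(* Let $d\in\{-163,-67,-43,-19,-11,-7,-3,-2,-1\}$ and work in $\mathcal O_{\mathbb{Q}(\sqrt{d})}$. Suppose $z\in\mathcal O_{\mathbb{Q}(\sqrt{d})}\setminus\{0\}$ satisfies $I_n^*(z)=t$ for some $n\in\{1,2\}$ and some $t\in\mathbb{N}\setminus\{1\}$. Then the norm $N(z)=z\bar z$ is even.
   Context: $\mathcal O_{\mathbb{Q}(\sqrt{d})}$ is $\mathbb{Z}[\frac{1+\sqrt d}{2}]$ if $d\equiv 1 \pmod 4$ and $\mathbb{Z}[\sqrt d]$ if $d\equiv 2,3\pmod 4$; for the listed $d$ it is a unique factorization domain. Viewing elements as complex numbers, $|z|=\sqrt{z\bar z}$ and $\arg(z)\in[0,2\pi)$. Define $A(d)$ to be the set of nonzero $z\in\mathcal O_{\mathbb{Q}(\sqrt{d})}$ with $0\le\arg(z)<\pi/2$ if $d=-1$, with $0\le \arg(z)<\pi/3$ if $d=-3$, and with $0\le\arg(z)<\pi$ otherwise. Two elements are relatively prime if they have no nonunit common divisor. For nonzero $x,z$, write $x\Diamond z$ iff $x\in A(d)$, $x\mid z$, and $x$ is relatively prime to $z/x$. For $m\in\mathbb{Z}$ define $\delta_m^*(z)=\sum_{x\Diamond z}|x|^m$ and $I_m^*(z)=\delta_m^*(z)/|z|^m$ for nonzero $z$. *)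

(* Defs.v *)
From HB Require Import structures.
From mathcomp Require Import all_boot all_order all_algebra.
From mathcomp Require Import all_classical all_reals all_analysis.
Set Implicit Arguments. Unset Strict Implicit. Unset Printing Implicit Defensive.
Import Order.TTheory GRing.Theory Num.Theory.
Local Open Scope ring_scope.
Local Open Scope classical_set_scope.

(* The ring of integers O_d of Q(sqrt d) (d squarefree, negative) is Z[w] with
   w = sqrt d            if d = 2,3 mod 4  (w^2 = d),
   w = (1 + sqrt d)/2    if d = 1 mod 4    (w^2 = w + (d-1)/4).
   In both cases w^2 = wp d * w + wq d.  An element a + b w is encoded as the
   pair (a, b) : int * int. *)
Definition wp (d : int) : int := if (d %% 4)%Z == 1 then 1 else 0.
Definition wq (d : int) : int := if (d %% 4)%Z == 1 then ((d - 1) %/ 4)%Z else d.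

Definition OK := (int * int)%type.
Definition zeroO : OK := (0, 0).
Definition oneO : OK := (1, 0).
(* (a + b w)(c + e w) = ac + be w^2 + (ae + bc) w *)
Definition mulO (d : int) (x y : OK) : OK :=
  (x.1 * y.1 + x.2 * y.2 * wq d, x.1 * y.2 + x.2 * y.1 + x.2 * y.2 * wp d).
(* complex conjugation: conj w = wp d - w *)
Definition conjO (d : int) (x : OK) : OK := (x.1 + x.2 * wp d, - x.2).
(* the norm N(z) = z * conj z (a rational integer, the first coordinate) *)
Definition normO (d : int) (x : OK) : int := (mulO d x (conjO d x)).1.

Definition dvdO (d : int) (x z : OK) : Prop := exists y : OK, z = mulO d x y.
Definition unitO (d : int) (u : OK) : Prop := exists v : OK, mulO d u v = oneO.
Definition coprimeO (d : int) (x y : OK) : Prop :=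
  forall c : OK, dvdO d c x -> dvdO d c y -> unitO d c.

(* the complex embedding: real and imaginary parts.
   Re w = wp d / 2,  Im w = sqrt (-(wp d + 4 wq d)) / 2 (= sqrt(-d) or sqrt(-d)/2). *)
Definition reO (R : realType) (d : int) (x : OK) : R :=
  x.1%:~R + x.2%:~R * (wp d)%:~R / 2.
Definition imO (R : realType) (d : int) (x : OK) : R :=
  x.2%:~R * Num.sqrt (- (wp d + 4 * wq d))%:~R / 2.
Definition absO (R : realType) (d : int) (x : OK) : R := Num.sqrt (normO d x)%:~R.

Definition argbound (R : realType) (d : int) : R :=
  if d == -1 then pi / 2 else if d == -3 then pi / 3 else pi.
(* x \in A(d): x nonzero and arg(x) \in [0, argbound d), where arg(x) is the
   unique theta in [0, 2 pi) with x = |x| (cos theta + i sin theta). *)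
Definition inA (R : realType) (d : int) (x : OK) : Prop :=
  x <> zeroO /\
  exists theta : R, 0 <= theta /\ theta < argbound R d /\
    reO R d x = absO R d x * cos theta /\ imO R d x = absO R d x * sin theta.

(* x <> z : x in A(d), x | z, and x relatively prime to z/x
   (z/x is the unique y with z = x y, since x <> 0). *)
Definition diamond (R : realType) (d : int) (x z : OK) : Prop :=
  inA R d x /\ exists y : OK, z = mulO d x y /\ coprimeO d x y.

Definition delta_star (R : realType) (d : int) (m : nat) (z : OK) : R :=
  \sum_(x \in [set x | diamond R d x z]) absO R d x ^+ m.
Definition I_star (R : realType) (d : int) (m : nat) (z : OK) : R :=
  delta_star R d m z / absO R d z ^+ m.

(* Main.v *)
(* Up to associates, z is a product of pairwise coprime factors q that admit no
   nontrivial coprime factorization. The unitary divisors of z are exactly the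
   subproducts, because O_d is a Bezout domain by the Dedekind-Hasse criterion,
   so delta*_n(z) = prod (1 + |q|^n).
   If n = 1, then sum |x| |z| = t N(z) is a rational sum of positive square roots
   of integers, so every |x| |z| is rational, and every |x| is an integer. Hence
   for n = 1, 2 all |q|^n are integers k > 1 with prod (1 + k) = t prod k. If N(z)
   is odd, all k are odd, so 2^r divides t where r is the number of factors;
   but t = prod (1 + 1/k) < 2^r unless r = 0, in which case t = 1. *)
Require Import Defs.
From HB Require Import structures.
From mathcomp Require Import all_boot all_order all_algebra.
From mathcomp Require Import all_classical all_reals all_analysis.
From mathcomp Require Import zify ring lra.
Import Defs.
Set Implicit Arguments.
Unset Strict Implicit.
Unset Printing Implicit Defensive.
Import Order.TTheory GRing.Theory Num.Theory.
Local Open Scope ring_scope.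

(** * Sums of positive square roots *)

(** A predicate on a fixed ambient field, so that quadratic extensions can be formed inside it. As
    [x / 0] is [0], closure under quotients is stated for all [y]. *)
Definition subfield (F : fieldType) (K : F -> Prop) : Prop :=
  [/\ K 1, forall x y, K x -> K y -> K (x - y) & forall x y, K x -> K y -> K (x / y)].

Definition adjoin (F : fieldType) (K : F -> Prop) (s x : F) : Prop :=
  exists a b, [/\ K a, K b & x = a + b * s].

Lemma subfield0 (F : fieldType) (K : F -> Prop) : subfield K -> K 0.
Proof. by case=> K1 KB _; rewrite -(subrr 1); apply: (KB). Qed.

Lemma subfieldD (F : fieldType) (K : F -> Prop) (x y : F) :
  subfield K -> K x -> K y -> K (x + y).
Proof.
move=> Ks Kx Ky; have K0 := subfield0 Ks; case: Ks => _ KB _.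
by rewrite -[y]opprK; apply: (KB) => //; rewrite -sub0r; apply: (KB).
Qed.

Lemma subfieldM (F : fieldType) (K : F -> Prop) (x y : F) :
  subfield K -> K x -> K y -> K (x * y).
Proof.
move=> [K1 _ KV] Kx Ky; rewrite -[y]invrK; apply: (KV) => //.
by rewrite -div1r; apply: (KV).
Qed.

Lemma sub_adjoin (F : fieldType) (K : F -> Prop) (s x : F) :
  subfield K -> K x -> adjoin K s x.
Proof. by move=> /subfield0 K0 Kx; exists x, 0; rewrite mul0r addr0. Qed.

(** Inverses come from rationalising denominators. For [c + e * s] nonzero, the conjugate
    [c - e * s] can vanish only if [s] lies in [K], a case settled first. *)
Lemma subfield_adjoin (F : fieldType) (K : F -> Prop) (s : F) :
  subfield K -> K (s ^+ 2) -> subfield (adjoin K s).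
Proof.
move=> Ks Ks2; have K0 := subfield0 Ks; have [K1 KB KV] := Ks.
split; first exact: sub_adjoin.
  move=> _ _ [a [b [Ka Kb ->]]] [c [e [Kc Ke ->]]]; exists (a - c), (b - e).
  by split; [exact: KB | exact: KB | ring].
move=> x y [a [b [Ka Kb ->]]] [c [e [Kc Ke ->]]].
have [Kss|nKs] := pselect (K s).
  by apply: sub_adjoin => //; apply: (KV); apply: subfieldD => //; apply: subfieldM.
have [->|y0] := eqVneq (c + e * s) 0.
  by rewrite invr0 mulr0; apply: sub_adjoin.
have y'0 : c - e * s != 0.
  apply/eqP => h; have [e0|e0] := eqVneq e 0.
    by move: h y0; rewrite e0 !mul0r subr0 addr0 => ->; rewrite eqxx.
  apply: nKs; have -> : s = c / e; last exact: KV.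
  by apply: (mulfI e0); rewrite [RHS]mulrC divfK //; apply/esym/eqP; rewrite -subr_eq0 h.
pose N := c * c - e * e * s ^+ 2.
have NE : N = (c + e * s) * (c - e * s) by rewrite /N; ring.
have KN : K N by apply: (KB); [|apply: subfieldM => //]; apply: subfieldM.
exists ((a * c - b * e * s ^+ 2) / N), ((b * c - a * e) / N); split.
- by apply: (KV) => //; apply: (KB); apply: subfieldM => //; apply: subfieldM.
- by apply: (KV) => //; apply: (KB); apply: subfieldM.
- by rewrite NE; field; rewrite ?y0 ?y'0.
Qed.

(** Induction on the list, over all subfields [K]. For the head [x], the induction hypothesis over
    K(x) writes every other term as a + b x; its square being in [K], either a or b is 0 unless [x]
    is in [K]. Positivity keeps the multiples of [x] from cancelling. *)
Lemma positive_sqrt_sum (F : realFieldType) (K : F -> Prop) (l : seq F) : subfield K ->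
  (forall x, x \in l -> 0 < x /\ K (x ^+ 2)) -> K (\sum_(x <- l) x) ->
  forall x, x \in l -> K x.
Proof.
elim: l K => // x l IH K Ks hl; rewrite big_cons => KT.
have [x0 Kx2] := hl x (mem_head _ _).
have hl' y : y \in l -> 0 < y /\ K (y ^+ 2).
  by move=> yl; apply: hl; rewrite inE yl orbT.
have [K1 KB KV] := Ks.
suff Kx : K x.
  move=> y; rewrite inE => /predU1P[-> //|]; apply: IH => //.
  by rewrite -[X in K X](addKr x) addrC; apply: (KB).
have [//|nKx] := pselect (K x).
have Ls := subfield_adjoin Ks Kx2.
have lL y : y \in l -> adjoin K x y.
  apply: IH => // [w /hl'[w0 Kw]|]; first by split=> //; apply: sub_adjoin.
  have [_ LB _] := Ls; rewrite -[X in adjoin _ _ X](addKr x) addrC.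
  apply: (LB); first exact: sub_adjoin.
  by exists 0, 1; rewrite mul1r add0r; split=> //; apply: subfield0.
(* Each term of the tail is in [K] or a positive multiple of [x], hence B >= 0. *)
have [A [B [KA KB' B0 E]]] : exists A B,
    [/\ K A, K B, 0 <= B & \sum_(y <- l) y = A + B * x].
  move: lL hl' {IH hl KT}; elim: l => [|y l IHl] lL hl'.
    by exists 0, 0; rewrite big_nil mul0r addr0; split=> //; apply: subfield0.
  case: IHl => [w wl|w wl|A [B [KA KB' B0 sE]]].
  - by apply: lL; rewrite inE wl orbT.
  - by apply: hl'; rewrite inE wl orbT.
  have [y0 Ky2] := hl' y (mem_head _ _).
  have [a [b [Ka Kb yE]]] := lL y (mem_head _ _).
  rewrite big_cons sE.
  have [b0|b0] := eqVneq b 0.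
    exists (y + A), B; rewrite addrA; split=> //; apply: subfieldD => //.
    by rewrite yE b0 mul0r addr0.
  have [a0|a0] := eqVneq a 0.
    exists A, (b + B); split=> //; first exact: subfieldD.
      by rewrite addr_ge0 // -(pmulr_lge0 _ x0) ltW //; move: y0; rewrite yE a0 add0r.
    by rewrite yE a0; ring.
  (* With a and b both nonzero, y^2 = a^2 + b^2 x^2 + 2 a b x can be solved for [x] in [K]. *)
  case: nKx.
  have -> : x = (y ^+ 2 - (a * a + b * b * x ^+ 2)) / (a * b + a * b).
    rewrite yE; field; rewrite -mulr2n mulrn_eq0 /= mulf_neq0 //.
  have ? : K (a * b) by apply: subfieldM.
  apply: (KV); last exact: subfieldD.
  by apply: (KB) => //; apply: subfieldD => //; repeat apply: subfieldM => //.
have -> : x = (x + \sum_(y <- l) y - A) / (1 + B).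
  by rewrite E; field; rewrite gt_eqF // ltr_wpDr.
by apply: (KV); [apply: (KB) | apply: subfieldD].
Qed.

(** * Rational square roots of integers, and the parity argument on products *)

Lemma subfield_rat (F : numFieldType) : subfield (fun x : F => exists q : rat, x = ratr q).
Proof.
split; first by exists 1; rewrite rmorph1.
  by move=> _ _ [q ->] [r ->]; exists (q - r); rewrite rmorphB.
by move=> _ _ [q ->] [r ->]; exists (q / r); rewrite fmorph_div.
Qed.

(** In lowest terms the square of the denominator divides that of the numerator, so the denominator
    is 1. *)
Lemma rat_sqrt_nat (q : rat) (m : nat) : 0 <= q -> q ^+ 2 = m%:R ->
  exists k : nat, q = k%:R.
Proof.
move=> q0 qE.
have d1 : (`|denq q| = 1)%N.
  have E : numq q ^+ 2 = m%:Z * denq q ^+ 2.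
    apply: (@intr_inj rat); rewrite [RHS]rmorphM /= !rmorphXn /= numqE exprMn qE.
    by congr (_ * _); rewrite pmulrn.
  have : (`|denq q| ^ 2 %| `|numq q| ^ 2)%N.
    by rewrite -!abszX E abszM dvdn_mull.
  rewrite dvdn_pexp2r // => dv; have := coprime_num_den q.
  by rewrite coprime_sym /coprime (gcdn_idPl dv) => /eqP.
have d1' : denq q = 1 by have := denq_gt0 q; lia.
exists `|numq q|%N; rewrite -[LHS]divq_num_den d1' divr1.
by rewrite -[in LHS](gez0_abs (_ : 0 <= numq q)) ?numq_ge0.
Qed.

(** Each 1 + k is even and less than 2 k. With r factors, 2^r divides the left side and hence [t],
    the product of the k being odd; but size gives t < 2^r when r > 0. Without factors, t = 1 at
    once. *)
Lemma prod_succ_odd (T : eqType) (qs : seq T) (k : T -> nat) (t : nat) :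
  (forall q, q \in qs -> odd (k q) && (1 < k q)%N) ->
  (\prod_(q <- qs) (1 + k q) = t * \prod_(q <- qs) k q)%N -> t = 1%N.
Proof.
move=> kP; have [odd_prod dvd_prod lt_prod] : [/\ odd (\prod_(q <- qs) k q),
    (2 ^ size qs %| \prod_(q <- qs) (1 + k q))%N &
    ((0 < size qs) ==> (\prod_(q <- qs) (1 + k q) < 2 ^ size qs * \prod_(q <- qs) k q))%N].
  elim: qs kP => [|q qs IH] kP; first by rewrite !big_nil.
  have /andP[qo q1] := kP q (mem_head _ _).
  have [|o dv lt] := IH; first by move=> r rq; apply: kP; rewrite inE rq orbT.
  rewrite !big_cons /= oddM qo o expnS; split=> //.
    by rewrite dvdn_mul // dvdn2 oddD qo.
  have p0 := odd_gt0 o; case: qs lt {IH kP dv o} p0 => [|r qs] /= lt p0.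
    by rewrite !big_nil; lia.
  rewrite mulnACA; apply: (@ltn_trans (2 * k q * \prod_(j <- r :: qs) (1 + k j))).
    by rewrite ltn_pmul2r ?prodn_gt0 //; lia.
  by rewrite ltn_pmul2l //; lia.
have p0 := odd_gt0 odd_prod.
case: qs {kP} odd_prod dvd_prod lt_prod p0 => [|q qs] odd_prod dvd_prod lt_prod p0 E.
  by move: E; rewrite !big_nil muln1.
have : (2 ^ size (q :: qs) %| t)%N.
  by rewrite -(@Gauss_dvdl _ _ (\prod_(r <- q :: qs) k r)) -?E // coprimeXl // coprime2n.
have t0 : (0 < t)%N.
  by case: t E => // /eqP; rewrite mul0n eqn0Ngt prodn_gt0.
move/(dvdn_leq t0); rewrite leqNgt => /negP[].
by move: lt_prod; rewrite E /= ltn_pmul2r.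
Qed.

(** * The rings O_d *)

Notation class_one := [:: -163; -67; -43; -19; -11; -7; -3; -2; -1] (only parsing).

Implicit Types (d : int) (x y z a b c u v g : OK).

Lemma class_oneP d : d \in class_one ->
  [\/ [\/ d = -163, d = -67 | d = -43], [\/ d = -19, d = -11 | d = -7]
    | [\/ d = -3, d = -2 | d = -1]].
Proof.
by rewrite !inE; do 8?[case/orP]; move/eqP->;
  [do 3!constructor 1|constructor 1; constructor 2|constructor 1; constructor 3
  |constructor 2; constructor 1|constructor 2; constructor 2
  |constructor 2; constructor 3|constructor 3; constructor 1
  |constructor 3; constructor 2|constructor 3; constructor 3].
Qed.

(** Minus the discriminant p^2 + 4 q of X^2 - p X - q, the minimal polynomial of w; p^2 = p because
    p is 0 or 1. *)
Definition abs_disc d : int := - (wp d + 4 * wq d).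

Lemma wp_idem d : wp d * wp d = wp d.
Proof. by rewrite /wp; case: ifP; rewrite ?mulr1 ?mulr0. Qed.

Lemma normOE d x : normO d x = x.1 ^+ 2 + wp d * x.1 * x.2 - wq d * x.2 ^+ 2.
Proof. rewrite /normO /mulO /conjO /=; ring. Qed.

(** Completing the square gives a diagonal form, positive definite for the listed [d], from which
    signs, bounds and units are read off. *)
Lemma mulr4_normO d x :
  4 * normO d x = (2 * x.1 + wp d * x.2) ^+ 2 + abs_disc d * x.2 ^+ 2.
Proof.
rewrite normOE /abs_disc; have := wp_idem d; move: (wp d) (wq d) => p q pp.
have -> : (2 * x.1 + p * x.2) ^+ 2 =
  4 * x.1 ^+ 2 + 4 * p * x.1 * x.2 + (p * p) * x.2 ^+ 2 by ring.
rewrite pp; ring.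
Qed.

Lemma mulOC d x y : mulO d x y = mulO d y x.
Proof. rewrite /mulO; congr pair; ring. Qed.

Lemma mulOA d x y z : mulO d x (mulO d y z) = mulO d (mulO d x y) z.
Proof. rewrite /mulO /=; congr pair; ring. Qed.

Lemma mulOCA d x y z : mulO d x (mulO d y z) = mulO d y (mulO d x z).
Proof. by rewrite !mulOA (mulOC d x). Qed.

Lemma mulOAC d x y z : mulO d (mulO d x y) z = mulO d (mulO d x z) y.
Proof. by rewrite -!mulOA (mulOC d y). Qed.

Lemma mulOACA d x y z u :
  mulO d (mulO d x y) (mulO d z u) = mulO d (mulO d x z) (mulO d y u).
Proof. by rewrite -!mulOA (mulOCA d y). Qed.

Lemma mul1O d x : mulO d oneO x = x.
Proof. by case: x => x1 x2; rewrite /mulO /=; congr pair; ring. Qed.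

Lemma mulO1 d x : mulO d x oneO = x.
Proof. by rewrite mulOC mul1O. Qed.

Lemma mul0O d x : mulO d zeroO x = zeroO.
Proof. rewrite /mulO /zeroO /=; congr pair; ring. Qed.

Lemma mulO0 d x : mulO d x zeroO = zeroO.
Proof. by rewrite mulOC mul0O. Qed.

Lemma normOM d x y : normO d (mulO d x y) = normO d x * normO d y.
Proof.
rewrite !normOE /mulO /=; have := wp_idem d; move: (wp d) (wq d) => p q _.
ring.
Qed.

Lemma mulO_conj d x : mulO d x (conjO d x) = (normO d x, 0).
Proof. rewrite /normO {1}/mulO /mulO /conjO /=; congr pair; ring. Qed.

Lemma normO1 d : normO d oneO = 1.
Proof. by rewrite normOE /=; ring. Qed.

Lemma normO0 d : normO d zeroO = 0.
Proof. by rewrite normOE /=; ring. Qed.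

Lemma abs_disc_ge3 d : d \in class_one -> 3 <= abs_disc d.
Proof. by move/class_oneP => [] [] ->. Qed.

Lemma normO_ge0 d x : d \in class_one -> 0 <= normO d x.
Proof.
move=> /abs_disc_ge3 D3; have := mulr4_normO d x; have := sqr_ge0 x.2.
have := sqr_ge0 (2 * x.1 + wp d * x.2); nia.
Qed.

Lemma normO_eq0 d x : d \in class_one -> normO d x = 0 -> x = zeroO.
Proof.
move=> /abs_disc_ge3 D3 N0; have := mulr4_normO d x; rewrite N0.
case: x {N0} => x1 x2 /= E.
have x20 : x2 = 0 by have := sqr_ge0 (2 * x1 + wp d * x2); nia.
have x10 : x1 = 0 by move: E; rewrite x20; nia.
by rewrite x10 x20.
Qed.

Lemma normO_gt0 d x : d \in class_one -> x <> zeroO -> 0 < normO d x.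
Proof.
move=> hd x0; rewrite lt_neqAle normO_ge0 // andbT eq_sym.
by apply/eqP => /(normO_eq0 hd).
Qed.

Lemma mulO_eq0 d x y : d \in class_one -> mulO d x y = zeroO ->
  x = zeroO \/ y = zeroO.
Proof.
move=> hd /(congr1 (normO d)); rewrite normOM normO0 => /eqP.
rewrite mulf_eq0 => /orP[] /eqP /(normO_eq0 hd); by [left | right].
Qed.

Lemma mulO_neq0 d x y : d \in class_one -> x <> zeroO -> y <> zeroO ->
  mulO d x y <> zeroO.
Proof. by move=> hd x0 y0 /(mulO_eq0 hd) []. Qed.

Lemma mulOI d x y z : d \in class_one -> x <> zeroO ->
  mulO d x y = mulO d x z -> y = z.
Proof.
move=> hd x0 E; have : mulO d x (y.1 - z.1, y.2 - z.2) = zeroO.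
  move: E; rewrite /mulO => -[E1 E2] /=.
  rewrite /zeroO; congr pair.
    rewrite -[RHS](subrr (x.1 * y.1 + x.2 * y.2 * wq d)) {2}E1; ring.
  rewrite -[RHS](subrr (x.1 * y.2 + x.2 * y.1 + x.2 * y.2 * wp d)) {2}E2; ring.
case/(mulO_eq0 hd) => // -[/eqP + /eqP].
by rewrite !subr_eq0 => /eqP e1 /eqP e2; case: y z e1 e2 {E} => ? ? [? ?] /= -> ->.
Qed.

Lemma unitOP d u : d \in class_one -> unitO d u <-> normO d u = 1.
Proof.
move=> hd; split=> [[v /(congr1 (normO d))]|N1].
  rewrite normOM normO1 => uv1; have := normO_ge0 u hd.
  have : normO d u \is a GRing.unit by apply/unitrPr; exists (normO d v).
  by case/orP => /eqP ->.
by exists (conjO d u); rewrite mulO_conj N1.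
Qed.

Lemma unitO1 d : unitO d oneO.
Proof. by exists oneO; rewrite mulO1. Qed.

Lemma unitO_dvd d u v : dvdO d v u -> unitO d u -> unitO d v.
Proof. by move=> [y ->] [t tE]; exists (mulO d y t); rewrite mulOA. Qed.

Lemma dvdO_refl d x : dvdO d x x.
Proof. by exists oneO; rewrite mulO1. Qed.

Lemma dvdO_trans d y x z : dvdO d x y -> dvdO d y z -> dvdO d x z.
Proof. by move=> [s ->] [t ->]; exists (mulO d s t); rewrite mulOA. Qed.

Lemma dvdO_mulr d x y : dvdO d x (mulO d x y).
Proof. by exists y. Qed.

Lemma dvdO_mull d x y : dvdO d x (mulO d y x).
Proof. by exists y; rewrite mulOC. Qed.

Lemma coprimeO_sym d x y : coprimeO d x y -> coprimeO d y x.
Proof. by move=> co c cy cx; apply: co. Qed.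

Lemma coprimeO_dvd d x y a b : dvdO d a x -> dvdO d b y ->
  coprimeO d x y -> coprimeO d a b.
Proof.
by move=> ax bY co c ca cb; apply: co; [apply: dvdO_trans ca ax | apply: dvdO_trans cb bY].
Qed.

Lemma coprime1O d x : coprimeO d oneO x.
Proof. by move=> c c1 _; apply: unitO_dvd c1 (unitO1 d). Qed.

(** * Dirichlet approximation and the Dedekind-Hasse criterion *)

Definition addO x y : OK := (x.1 + y.1, x.2 + y.2).

Lemma mulOD d x y z : mulO d x (addO y z) = addO (mulO d x y) (mulO d x z).
Proof. rewrite /mulO /addO /=; congr pair; ring. Qed.

Lemma normO_conj d x : normO d (conjO d x) = normO d x.
Proof. rewrite !normOE /conjO /=; ring. Qed.

Lemma mulOZ d (k : int) x : mulO d (k, 0) x = (k * x.1, k * x.2).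
Proof. rewrite /mulO /=; congr pair; ring. Qed.

Lemma normOZ d (k : int) : normO d (k, 0) = k ^+ 2.
Proof. rewrite normOE /=; ring. Qed.

(** Pigeonhole on the residues of k b modulo n, 0 <= k <= K, in K + 1 boxes of width n / (K + 1). If
    a residue lies in the top box, rounding up suffices; otherwise two residues share one of the
    other K boxes, and the difference of their indices works. *)
Lemma dirichlet_approx (K : nat) (b n : int) : (0 < K)%N -> 0 < n ->
  exists k m : int, [/\ 1 <= k, k <= K%:Z & K.+1%:Z * `|k * b - m * n| <= n].
Proof.
move=> K0 n0; pose r (k : nat) := ((k%:Z * b) %% n)%Z.
have rE (k : nat) : k%:Z * b = ((k%:Z * b) %/ n)%Z * n + r k by apply: divz_eq.
have rE' (k : nat) : r k = k%:Z * b - ((k%:Z * b) %/ n)%Z * n.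
  by rewrite {1}rE addrAC subrr add0r.
have r0 (k : nat) : 0 <= r k by apply: modz_ge0; lia.
have rn (k : nat) : r k < n by apply: ltz_pmod.
pose bx (k : nat) := ((K.+1%:Z * r k) %/ n)%Z.
have b0 (k : nat) : 0 <= bx k by rewrite divz_ge0 // mulr_ge0.
have bK (k : nat) : bx k < K.+1%:Z by rewrite ltz_divLR // ltr_pM2l.
have bE (k : nat) : bx k * n <= K.+1%:Z * r k by apply: lez_floor; lia.
have bE' (k : nat) : K.+1%:Z * r k < (bx k + 1) * n by apply: ltz_ceil.
have [[i iK]|top] := pselect (exists i : 'I_K, bx i.+1 = K%:Z).
  exists i.+1%:Z, (((i.+1%:Z * b) %/ n)%Z + 1).
  split; [by [] | by rewrite lez_nat; exact: ltn_ord |].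
  rewrite {1}rE mulrDl mul1r opprD addrACA subrr add0r ler0_norm; last first.
    by have := rn i.+1; lia.
  by have := bE i.+1; rewrite iK; lia.
(* The index 0, absent from the case split above, has residue 0 and lies in the bottom box. *)
have bltK (k : 'I_K.+1) : (absz (bx k) < K)%N.
  have := bK k; have := b0 k; case: k => -[|k] kK /= h1 h2.
    by rewrite /bx /r mul0r mod0z mulr0 div0z.
  have kK' : (k < K)%N by [].
  have : bx k.+1 <> K%:Z by move=> e; apply: top; exists (Ordinal kK').
  lia.
pose f (k : 'I_K.+1) := Ordinal (bltK k).
have /injectivePn[i [j ij fij]] : ~~ injectiveb f.
  by apply/negP => /injectiveP /leq_card; rewrite !card_ord ltnn.
wlog lij : i j ij fij / (i < j)%N.
  move=> W; case: (ltngtP i j) => [l|l|l]; [exact: (W i j)| |].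
    by apply: (W j i) => //; rewrite eq_sym.
  by move: ij; rewrite -val_eqE /= l eqxx.
exists (j - i)%:Z, (((j%:Z * b) %/ n)%Z - ((i%:Z * b) %/ n)%Z).
have eb : bx i = bx j.
  by have := congr1 val fij; move: (b0 i) (b0 j) => /= ? ?; lia.
have jK := ltn_ord j; split; [lia | lia |].
have -> : (j - i)%:Z = j%:Z - i%:Z by lia.
have -> : (j%:Z - i%:Z) * b - (((j%:Z * b) %/ n)%Z - ((i%:Z * b) %/ n)%Z) * n =
  r j - r i by rewrite !rE'; ring.
have := bE i; have := bE j; have := bE' i; have := bE' j; rewrite eb.
have -> : K.+1%:Z * `|r j - r i| = `|K.+1%:Z * r j - K.+1%:Z * r i|.
  by rewrite -mulrBr normrM.
move: (K.+1%:Z * r i) (K.+1%:Z * r j) (bx j) => s t w.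
by rewrite mulrDl mul1r; move: (w * n) => ?; lia.
Qed.

(* Dirichlet's theorem with denominators up to [hasse_bound d] brings an element
   of the field within norm less than 1 of O_d, and all primes up to this bound
   are inert. *)
Definition hasse_bound d : nat :=
  if d \in [:: -163; -67; -43] then 7 else if d == -19 then 2 else 1.

(** Writing D for [abs_disc d] and K for the bound, a remainder with centred real part has 4 N <= 1
    + D / (K + 1)^2; the inequality makes this less than 4. *)
Lemma abs_disc_hasse d : d \in class_one ->
  abs_disc d < 3 * (hasse_bound d).+1%:Z ^+ 2.
Proof. by move/class_oneP => [] [] ->. Qed.

(** A prime is inert when the norm form has no nontrivial zero modulo p, which is a finite search
    over residue pairs. *)
Definition inert_below d (K : nat) : bool :=
  all (fun p : nat => prime p ==>
    all (fun i : nat => all (fun j : nat =>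
      (p %| normO d (i%:Z, j%:Z))%Z ==> (i == 0%N) && (j == 0%N))
    (iota 0 p)) (iota 0 p)) (iota 0 K.+1).

Lemma inert_hasse d : d \in class_one -> inert_below d (hasse_bound d).
Proof. by move/class_oneP => [] [] ->; vm_compute. Qed.

(** Reducing both coordinates modulo p changes the norm by a multiple of p, so the finite search
    applies to every element. *)
Lemma inert_dvd d (p : nat) x : d \in class_one -> prime p ->
  (p <= hasse_bound d)%N -> (p %| normO d x)%Z ->
  (p %| x.1)%Z && (p %| x.2)%Z.
Proof.
move=> hd pp pK; have p0 := prime_gt0 pp.
have hall := inert_hasse hd.
have /allP/(_ p) := hall; rewrite mem_iota add0n ltnS pK pp => /(_ isT) /= H.
have [i [a [ip E1]]] : exists (i : nat) (a : int), (i < p)%N /\ x.1 = a * p + i.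
  exists (absz (x.1 %% p)%Z), (x.1 %/ p)%Z; have := divz_eq x.1 p.
  have := modz_ge0 x.1 (_ : p%:Z != 0); have := @ltz_pmod x.1 p; lia.
have [j [b [jp E2]]] : exists (j : nat) (b : int), (j < p)%N /\ x.2 = b * p + j.
  exists (absz (x.2 %% p)%Z), (x.2 %/ p)%Z; have := divz_eq x.2 p.
  have := modz_ge0 x.2 (_ : p%:Z != 0); have := @ltz_pmod x.2 p; lia.
have -> : normO d x = normO d (i%:Z, j%:Z) + (a * a * p + 2 * a * i +
   wp d * (a * b * p + a * j + b * i) - wq d * (b * b * p + 2 * b * j)) * p.
  by rewrite !normOE E1 E2 /=; ring.
rewrite rpredDr ?dvdz_mull // => dv.
have /allP/(_ i) := H; rewrite mem_iota add0n ip => /(_ isT) /allP/(_ j).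
rewrite mem_iota add0n jp dv => /(_ isT) /andP[/eqP i0 /eqP j0].
by rewrite E1 E2 i0 j0 !addr0 !dvdz_mull.
Qed.

(** Dividing out smallest prime factors leads from k, where [P] holds, to 1, where it fails; some
    step loses [P]. *)
Lemma prime_step (P : nat -> Prop) (k : nat) : (0 < k)%N -> P k -> ~ P 1%N ->
  exists p j : nat, [/\ prime p, (p <= k)%N, ~ P j & P (p * j)%N].
Proof.
elim/ltn_ind: k => k IH k0 Pk P1.
have k1 : (1 < k)%N by case: k k0 Pk {IH} => [|[|k]].
have jE : (pdiv k * (k %/ pdiv k) = k)%N by rewrite mulnC divnK // pdiv_dvd.
have j0 : (0 < k %/ pdiv k)%N by rewrite divn_gt0 ?pdiv_gt0 // pdiv_leq.
have jk : (k %/ pdiv k < k)%N by rewrite ltn_Pdiv // prime_gt1 // pdiv_prime.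
have [Pj|nPj] := pselect (P (k %/ pdiv k)%N).
  have [p [j [? pj ? ?]]] := IH _ jk j0 Pj P1.
  by exists p, j; split=> //; apply: leq_trans pj (ltnW jk).
by exists (pdiv k), (k %/ pdiv k)%N; rewrite jE pdiv_prime // pdiv_leq.
Qed.

(** With A = x conj(y), the quotient x / y is A / n. Dirichlet's theorem gives k for which some g =
    k x - (l + m w) y has norm below n. If g = 0, then y divides k x, and inertness of the primes up
    to k yields another combination. *)
Lemma dedekind_hasse d x y : d \in class_one -> y <> zeroO -> ~ dvdO d y x ->
  exists u v, let g := addO (mulO d u x) (mulO d v y) in
    g <> zeroO /\ normO d g < normO d y.
Proof.
move=> hd y0 ndv; set n := normO d y.
have n0 : 0 < n by apply: normO_gt0.
pose A := mulO d x (conjO d y).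
have K0 : (0 < hasse_bound d)%N by rewrite /hasse_bound; do 2?case: ifP.
have [k [m [k1 kK Ke]]] := dirichlet_approx A.2 K0 n0.
set e := _ - _ in Ke.
have De : abs_disc d * e ^+ 2 < 3 * n ^+ 2.
  have D3 := abs_disc_ge3 hd; have DK := abs_disc_hasse hd.
  move: DK Ke; set L : int := _.+1%:Z; move=> DK Ke.
  have L0 : 0 < L by [].
  have Le : L ^+ 2 * e ^+ 2 <= n ^+ 2.
    rewrite -exprMn -[X in X <= _]ger0_norm ?sqr_ge0 // normrX normrM.
    by rewrite (gtr0_norm L0) ler_sqr ?nnegrE ?mulr_ge0 //; apply: ltW.
  have [e0|e0] := eqVneq (e ^+ 2) 0; first by rewrite e0 mulr0; nia.
  have e20 : 0 < e ^+ 2 by rewrite lt_neqAle eq_sym e0 sqr_ge0.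
  by apply: (@lt_le_trans _ _ (3 * L ^+ 2 * e ^+ 2)); [rewrite ltr_pM2r | nia].
have [l [hl1 hl2]] : exists l : int,
    - n <= 2 * (k * A.1 - l * n) + wp d * e /\ 2 * (k * A.1 - l * n) + wp d * e <= n.
  pose Y := 2 * (k * A.1) + wp d * e.
  (* Rounding Y / (2 n) to the nearest integer centres the real part. *)
  exists ((Y + n) %/ (2 * n))%Z.
  have := lez_floor (Y + n) (_ : 2 * n != 0); have := @ltz_ceil (Y + n) (2 * n).
  by rewrite /Y; lia.
pose u : OK := (k, 0); pose v : OK := (- l, - m).
pose g := addO (mulO d u x) (mulO d v y).
have gE : mulO d g (conjO d y) = (k * A.1 - l * n, e).
  have -> : mulO d g (conjO d y) = addO (mulO d u A) (mulO d v (n, 0)).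
    by rewrite mulOC mulOD -mulO_conj /A !(mulOC d (conjO d y)) !mulOA.
  rewrite /u mulOZ (mulOC d v) mulOZ /addO /e /=; congr pair; ring.
have Ng : normO d g < n.
  have : normO d g * n * 4 < n * n * 4.
    rewrite -{1}[n]/(normO d y) -(normO_conj d y) -normOM gE.
    rewrite mulrC mulr4_normO [(_, _).1]/= [(_, _).2]/=.
    have -> : n * n * 4 = n ^+ 2 + 3 * n ^+ 2 by ring.
    apply: ler_ltD => //; move: hl1 hl2; move: (_ + _) => s hl1 hl2.
    by rewrite -(real_normK (num_real s)) ler_sqr ?nnegrE ?(ltW n0) // ler_norml hl1.
  by rewrite ltr_pM2r // ltr_pM2r.
have [g0|g0] := pselect (g = zeroO); last by exists u, v.
(* Now g = 0, so y divides k x but not x. This yields a prime p <= k and j with p j x = y s and y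
   not dividing j x. *)
have kx : dvdO d y (mulO d (k, 0) x).
  exists (l, m); move: g0; rewrite /g /u /v /addO /mulO /zeroO /= => -[E1 E2].
  congr pair; lia.
pose P (j : nat) := dvdO d y (mulO d (j%:Z, 0) x).
have Pk : P (absz k) by rewrite /P gez0_abs //; lia.
have nP1 : ~ P 1%N by rewrite /P (mul1O d x).
have [p [j [pp pk nPj [s Es]]]] : exists p j : nat,
  [/\ prime p, (p <= absz k)%N, ~ P j & P (p * j)%N] by apply: prime_step => //; lia.
have p0 := prime_gt0 pp; have pK : (p <= hasse_bound d)%N by lia.
have pjE : mulO d (p%:Z, 0) (mulO d (j%:Z, 0) x) = mulO d y s.
  by rewrite -Es mulOA; congr mulO; rewrite mulOZ /= mulr0 PoszM.
have pO : ((p%:Z, 0) : OK) <> zeroO by case; lia.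
(* If p divided N(s), inertness would give p | s, and cancelling p would give y | j x. *)
have nps : ~~ (p %| normO d s)%Z.
  apply/negP => /(inert_dvd hd pp pK) /andP[/dvdzP[s1 E1] /dvdzP[s2 E2]].
  apply: nPj; exists (s1, s2); apply: (mulOI hd pO).
  rewrite pjE mulOCA; congr mulO; rewrite mulOZ /=.
  by case: s E1 E2 {Es pjE} => a b /= -> ->; rewrite !(mulrC p%:Z).
pose r := (normO d s %% p)%Z; pose q := (normO d s %/ p)%Z.
have Nr : normO d s = q * p + r by apply: divz_eq.
have pZ : 0 < p%:Z by rewrite ltz_nat.
have r0 : 0 < r.
  rewrite lt0r modz_ge0; first by rewrite andbT; apply: contra nps => /eqP ?; apply/dvdz_mod0P.
  by rewrite lt0r_neq0.
have rp : r < p by apply: ltz_pmod.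
(* Since conj(s) p j x = N(s) y, the element conj(s) j x - q y equals (r / p) y, which is nonzero
   and has norm (r / p)^2 n < n. *)
pose u' := mulO d (conjO d s) (j%:Z, 0); pose v' : OK := (- q, 0).
exists u', v'; set g' := addO _ _.
have pg : mulO d (p%:Z, 0) g' = mulO d (r, 0) y.
  rewrite /g' mulOD /u' -(mulOA d (conjO d s)) mulOCA pjE mulOCA (mulOC d (conjO d s)).
  rewrite mulO_conj Nr mulOC /v' !mulOZ /addO /=; congr pair; ring.
have /(congr1 (normO d)) := pg; rewrite !normOM !normOZ -/n => Npg.
have N0 : 0 < p%:Z ^+ 2 * normO d g' by rewrite Npg mulr_gt0 // exprn_gt0.
split; first by move=> g'0; move: N0; rewrite g'0 normO0 mulr0.
have pp0 : 0 < p%:Z ^+ 2 by rewrite exprn_gt0.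
by rewrite -(ltr_pM2l pp0) Npg ltr_pM2r // ltr_pXn2r ?nnegrE ?ltW.
Qed.

(** * Bezout combinations, Gauss's lemma and greatest common divisors *)

Lemma addOACA x y z u :
  addO (addO x y) (addO z u) = addO (addO x z) (addO y u).
Proof. rewrite /addO /=; congr pair; ring. Qed.

Lemma mulODl d x y z : mulO d (addO y z) x = addO (mulO d y x) (mulO d z x).
Proof. by rewrite mulOC mulOD !(mulOC d x). Qed.

(** A nonzero combination of least norm divides every combination, as otherwise [dedekind_hasse]
    would give a smaller one. *)
Lemma bezoutO d x y : d \in class_one -> y <> zeroO ->
  exists u v, let g := addO (mulO d u x) (mulO d v y) in
    [/\ g <> zeroO, dvdO d g x & dvdO d g y].
Proof.
move=> hd y0; pose comb g := exists u v, g = addO (mulO d u x) (mulO d v y).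
have combD u s v t : comb s -> comb t -> comb (addO (mulO d u s) (mulO d v t)).
  move=> [s1 [s2 ->]] [t1 [t2 ->]].
  exists (addO (mulO d u s1) (mulO d v t1)), (addO (mulO d u s2) (mulO d v t2)).
  by rewrite !mulOD !mulODl addOACA !mulOA.
have combx : comb x by exists oneO, zeroO; rewrite mul1O mul0O;
  case: (x) => ? ?; rewrite /addO !addr0.
have comby : comb y by exists zeroO, oneO; rewrite mul1O mul0O;
  case: (y) => ? ?; rewrite /addO !add0r.
have [g [g0 cg gmin]] : exists g, [/\ g <> zeroO, comb g &
    forall h, comb h -> h <> zeroO -> normO d g <= normO d h].
  suff H k g : (absz (normO d g) < k)%N -> g <> zeroO -> comb g ->
      exists g, [/\ g <> zeroO, comb g &
        forall h, comb h -> h <> zeroO -> normO d g <= normO d h].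
    exact: (H _ y (ltnSn _)).
  elim: k g => // k IH g gk g0 cg.
  have [[h [ch h0 hg]]|nh] :=
      pselect (exists h, [/\ comb h, h <> zeroO & normO d h < normO d g]).
    apply: (IH h) => //; have := normO_ge0 h hd; move: hg gk.
    by move: (normO d h) (normO d g) => s t; lia.
  exists g; split=> // h ch h0; rewrite leNgt; apply/negP => hg.
  by apply: nh; exists h.
have gdvd w : comb w -> dvdO d g w.
  move=> cw; have [//|nd] := pselect (dvdO d g w).
  have [u [v [h0]]] := dedekind_hasse hd g0 nd.
  by rewrite ltNge gmin //; apply: combD.
have [u [v gE]] := cg; exists u, v; rewrite /= -gE.
by split=> //; apply: gdvd.
Qed.

(** By Bezout some u x + v y is a unit; after multiplication by z both terms are multiples of x. *)
Lemma gaussO d x y z : d \in class_one -> y <> zeroO ->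
  coprimeO d x y -> dvdO d x (mulO d y z) -> dvdO d x z.
Proof.
move=> hd y0 co [s yz]; have [u [v]] := bezoutO x hd y0.
case=> _ /co /[apply] -[t gt].
exists (addO (mulO d (mulO d t u) z) (mulO d (mulO d t v) s)).
have /(congr1 (mulO d z)) := gt.
rewrite mulO1 mulODl mulOD => zE; rewrite -{1}zE mulOD; congr addO.
  rewrite /mulO /=; congr pair; ring.
rewrite (mulOCA d x) -yz /mulO /=; congr pair; ring.
Qed.

(** Cancelling g in g = u x + v y gives 1 = u a + v b, so a and b are coprime. *)
Lemma gcdO_decomp d x y : d \in class_one -> y <> zeroO ->
  exists g a b, [/\ x = mulO d g a, y = mulO d g b & coprimeO d a b].
Proof.
move=> hd y0; have [u [v]] := bezoutO x hd y0.
set g := addO _ _ => -[g0 [a xE] [b yE]].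
exists g, a, b; split=> // c [a' aE] [b' bE].
exists (addO (mulO d u a') (mulO d v b')); apply: (mulOI hd g0).
rewrite mulO1 -[RHS]/(addO (mulO d u x) (mulO d v y)) xE yE aE bE !mulOD.
by congr addO; rewrite /mulO /=; congr pair; ring.
Qed.

Lemma coprimeOM d x y z : d \in class_one -> y <> zeroO ->
  coprimeO d x y -> coprimeO d x z -> coprimeO d x (mulO d y z).
Proof.
move=> hd y0 xy xz c cx cyz; apply: xz => //; apply: gaussO cyz => //.
exact: coprimeO_dvd cx (dvdO_refl d y) xy.
Qed.

(** * The sector A(d) *)

(** The triple angle formula at pi / 3 reads (c + 1) (2 c - 1)^2 = 0, and c > 0. *)
Lemma cos_pi_third (R : realType) : cos (pi / 3 : R) = 1 / 2.
Proof.
set c := cos _; have pi0 := pi_gt0 R.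
have c0 : 0 < c by apply: cos_gt0_pihalf; apply/andP; split; lra.
have c2 : cos (pi / 3 + pi / 3 : R) = 2 * c ^+ 2 - 1.
  by rewrite cosD -!expr2 sin2cos2 -/c; ring.
have : cos (pi / 3 + (pi / 3 + pi / 3) : R) = - 1 by rewrite -cospi; congr cos; field.
rewrite cosD c2 sinD; set s := sin _; rewrite -/c => h.
have cs : c * s ^+ 2 = c * (1 - c ^+ 2) by rewrite /s sin2cos2.
have : (c + 1) * (2 * c - 1) ^+ 2 = 0 by move: h cs; lra.
move/eqP; rewrite mulf_eq0 sqrf_eq0 => /orP[/eqP|/eqP]; lra.
Qed.

(* On [0, pi] the sine is nonnegative and the cosine decreasing, so a bound on
   the argument is a bound on the cosine. *)
Lemma polar_bound (R : realType) (a b r B : R) : 0 < r -> r ^+ 2 = a ^+ 2 + b ^+ 2 ->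
  0 < B -> B <= pi ->
  (exists theta : R, 0 <= theta /\ theta < B /\
    a = r * cos theta /\ b = r * sin theta) <-> 0 <= b /\ r * cos B < a.
Proof.
move=> r0 rE B0 Bpi; split=> [[th [th0 [thB [-> ->]]]]|[b0 ra]].
  split.
    by rewrite mulr_ge0 ?(ltW r0) // sin_ge0_pi // th0 (le_trans (ltW thB)).
  rewrite ltr_pM2l // ltr_cos // in_itv /= ?th0 ?(le_trans (ltW thB)) //.
  by rewrite (ltW B0).
have br2 : (b / r) ^+ 2 = 1 - (a / r) ^+ 2.
  rewrite !expr_div_n; apply: (mulIf (_ : r ^+ 2 != 0)).
    by rewrite expf_neq0 // gt_eqF.
  by rewrite mulrBl !mulfVK ?expf_neq0 ?gt_eqF // rE; ring.
have c1 : -1 <= a / r <= 1.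
  have : (a / r) ^+ 2 <= 1 by have := sqr_ge0 (b / r); lra.
  by rewrite -[X in _ <= X](expr1n R 2) -(real_normK (num_real _)) ler_sqr ?nnegrE // ler_norml.
exists (acos (a / r)); rewrite acos_ge0 //; split=> //.
rewrite acosK ?in_itv //; split; last split.
- rewrite -ltr_cos ?in_itv /= ?acos_ge0 ?acos_lepi // ?(ltW B0) //.
  by rewrite acosK ?in_itv // ltr_pdivlMr // mulrC.
- by rewrite mulrC mulfVK // gt_eqF.
- rewrite sin_acos // -br2 sqrtr_sqr ger0_norm ?divr_ge0 ?(ltW r0) //.
  by rewrite mulrC mulfVK // gt_eqF.
Qed.

(** A(d) in integer coordinates. For -3, w is exp(i pi / 3), so the sector is the cone spanned by 1
    and w without the ray of w; in the generic case it is the open upper half-plane with the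
    positive real axis. *)
Definition in_sector d x : bool :=
  if (d == -1) || (d == -3) then (0 < x.1) && (0 <= x.2)
  else (0 < x.2) || (x.2 == 0) && (0 < x.1).

Lemma absO_sqr (R : realType) d x : d \in class_one ->
  absO R d x ^+ 2 = (normO d x)%:~R.
Proof. by move=> hd; rewrite sqr_sqrtr // ler0z normO_ge0. Qed.

Lemma absO_gt0 (R : realType) d x : d \in class_one -> x <> zeroO -> 0 < absO R d x.
Proof. by move=> hd x0; rewrite sqrtr_gt0 ltr0z normO_gt0. Qed.

Lemma absO_re_im (R : realType) d x : d \in class_one ->
  absO R d x ^+ 2 = reO R d x ^+ 2 + imO R d x ^+ 2.
Proof.
move=> hd; rewrite absO_sqr //; apply: (@mulfI _ 4%:R) => //.
have /(congr1 (fun n : int => n%:~R : R)) := mulr4_normO d x.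
rewrite rmorphM /= => ->.
have D0 : 0 <= (abs_disc d)%:~R :> R by rewrite ler0z; have := abs_disc_ge3 hd; lia.
have -> : (4%:R : R) * (reO R d x ^+ 2 + imO R d x ^+ 2) =
    (2 * x.1%:~R + (wp d)%:~R * x.2%:~R) ^+ 2 +
    (Num.sqrt (abs_disc d)%:~R) ^+ 2 * x.2%:~R ^+ 2.
  by rewrite /reO /imO -/(abs_disc d); field.
by rewrite sqr_sqrtr // !(rmorphD, rmorphM, rmorphXn).
Qed.

Lemma imO_ge0 (R : realType) d x : d \in class_one -> (0 <= imO R d x) = (0 <= x.2).
Proof.
move=> hd; rewrite /imO -mulrA pmulr_lge0 ?ler0z //.
rewrite divr_gt0 // sqrtr_gt0 ltr0z -/(abs_disc d).
by have := abs_disc_ge3 hd; lia.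
Qed.

(** By [polar_bound], membership means Im x >= 0 and Re x > |x| cos B, where cos B is 0, 1/2 or
    -1. *)
Lemma inAP (R : realType) d x : d \in class_one -> inA R d x <-> in_sector d x.
Proof.
move=> hd; have pi0 := pi_gt0 R.
have B0 : 0 < argbound R d by rewrite /argbound; do 2?case: ifP => _; lra.
have Bpi : argbound R d <= pi by rewrite /argbound; do 2?case: ifP => _; lra.
have [x0|x0] := pselect (x = zeroO).
  by rewrite x0 /in_sector /inA; split; [case | case: ifP].
have r0 := absO_gt0 R hd x0; have rE := absO_re_im R x hd.
have -> : inA R d x <-> 0 <= x.2 /\ absO R d x * cos (argbound R d) < reO R d x.
  rewrite -(imO_ge0 R x hd) -(polar_bound r0 rE B0 Bpi).
  by split=> [[]|].
rewrite /in_sector; have [d1|d1] /= := eqVneq d (-1).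
  rewrite /argbound d1 eqxx cos_pihalf mulr0 /reO /wp /= mulr0 mul0r addr0 ltr0z.
  by rewrite andbC; split=> [[-> ->]|/andP[]].
have [d3|d3] /= := eqVneq d (-3).
  rewrite /argbound d3 /= cos_pi_third.
  (* For b >= 0 and r^2 = a^2 + a b + b^2, the condition r < 2 a + b amounts to a > 0, because (2 a
     + b)^2 - r^2 = 3 a (a + b). *)
  have NE := absO_sqr R x hd; move: r0 NE; rewrite d3 normOE.
  have -> : wp (-3) = 1 by [].
  have -> : wq (-3) = -1 by [].
  move=> r0 NE.
  have {}NE : absO R (-3) x ^+ 2 = x.1%:~R ^+ 2 + x.1%:~R * x.2%:~R + x.2%:~R ^+ 2.
    by rewrite NE !(rmorphD, rmorphM, rmorphXn, rmorphN) /=; ring.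
  rewrite /reO /= -(ltr0z R) -(ler0z R).
  move: r0 NE; move: (absO _ _ _) (x.1%:~R : R) (x.2%:~R : R) => r a b r0 NE.
  split=> [[b0 h]|/andP[a0 b0]].
    by rewrite b0 andbT ltNge; apply/negP => a0; nra.
  by split=> //; nra.
(* In the closed upper half-plane, -|x| < Re x excludes only the negative real axis. *)
rewrite /argbound (negbTE d1) (negbTE d3) cospi mulrN1.
case: (ltgtP 0 x.2) => [x2|x2|x2] /=.
- split=> // _; split=> //.
  have i0 : 0 < imO R d x.
    rewrite /imO -mulrA pmulr_rgt0 ?ltr0z //.
    rewrite divr_gt0 // sqrtr_gt0 ltr0z -/(abs_disc d).
    by have := abs_disc_ge3 hd; lia.
  by move: r0 rE i0; move: (absO _ _ _) (reO _ _ _) (imO _ _ _) => r a b; nra.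
- by split=> // -[].
- have i0 : imO R d x = 0 by rewrite /imO -x2 !mul0r.
  move: r0 rE; rewrite i0 expr0n addr0 /reO -x2 !mul0r addr0 -(ltr0z R) => r0 rE.
  move: r0 rE; move: (absO _ _ _) (x.1%:~R : R) => r a r0 rE; split=> [[_ h]|a0].
    by rewrite ltNge; apply/negP => a0; nra.
  by split=> //; lra.
Qed.

(** * Existence and uniqueness of the associate in the sector *)

Lemma sector_exists d x : d \in class_one -> x <> zeroO ->
  exists u, unitO d u /\ in_sector d (mulO d u x).
Proof.
move=> hd; case: x => a b x0.
have U u : normO d u = 1 -> unitO d u by move/(unitOP u hd).
have [d1|d1] := eqVneq d (-1).
  (* Four half-open quadrants, brought to the first by 1, -i, -1, i in this order. *)
  have : [\/ 0 < a /\ 0 <= b, 0 < b /\ a <= 0, a < 0 /\ b <= 0 | b < 0 /\ 0 <= a].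
    have : ~ (a = 0 /\ b = 0) by move=> [a0 b0]; apply: x0; rewrite a0 b0.
    case: (ltgtP a 0) => ?; case: (ltgtP b 0) => ? h;
      by [constructor 1; lia | constructor 2; lia | constructor 3; lia
         | constructor 4; lia | lia].
  have mE v : mulO d v (a, b) = (v.1 * a - v.2 * b, v.1 * b + v.2 * a).
    by rewrite d1 /mulO; congr pair; rewrite -?[wp _]/(0 : int) -?[wq _]/(-1 : int) /=; ring.
  rewrite /in_sector d1 eqxx orTb; rewrite d1 in U mE.
  case=> -[? ?].
  - by exists (1, 0); split; [apply: U|rewrite mE /=; lia].
  - by exists (0, -1); split; [apply: U|rewrite mE /=; lia].
  - by exists (-1, 0); split; [apply: U|rewrite mE /=; lia].
  - by exists (0, 1); split; [apply: U|rewrite mE /=; lia].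
have [d3|d3] := eqVneq d (-3).
  (* Six half-open sextants, brought to the first by 1, w, w^2, -1, -w, -w^2 in this order. *)
  have : [\/ [\/ 0 < a /\ 0 <= b, b < 0 /\ 0 <= a + b | a + b < 0 /\ 0 <= a]
           | [\/ a < 0 /\ b <= 0, 0 < b /\ a + b <= 0 | 0 < a + b /\ a <= 0]].
    have : ~ (a = 0 /\ b = 0) by move=> [a0 b0]; apply: x0; rewrite a0 b0.
    case: (ltgtP a 0) => ?; case: (ltgtP b 0) => ?; case: (ltgtP (a + b) 0) => ? h;
      by [constructor 1; constructor 1; lia | constructor 1; constructor 2; lia
         | constructor 1; constructor 3; lia | constructor 2; constructor 1; lia
         | constructor 2; constructor 2; lia | constructor 2; constructor 3; lia | lia].
  have mE v : mulO d v (a, b) = (v.1 * a - v.2 * b, v.1 * b + v.2 * a + v.2 * b).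
    by rewrite d3 /mulO; congr pair; rewrite -?[wp _]/(1 : int) -?[wq _]/(-1 : int) /=; ring.
  rewrite /in_sector d3 eqxx orbT; rewrite d3 in U mE.
  case=> -[] [? ?].
  - by exists (1, 0); split; [apply: U|rewrite mE /=; lia].
  - by exists (0, 1); split; [apply: U|rewrite mE /=; lia].
  - by exists (-1, 1); split; [apply: U|rewrite mE /=; lia].
  - by exists (-1, 0); split; [apply: U|rewrite mE /=; lia].
  - by exists (0, -1); split; [apply: U|rewrite mE /=; lia].
  - by exists (1, -1); split; [apply: U|rewrite mE /=; lia].
rewrite /in_sector (negbTE d1) (negbTE d3) /=.
have : [\/ 0 < b, b = 0 /\ 0 < a | b < 0 \/ b = 0 /\ a < 0].
  have : ~ (a = 0 /\ b = 0) by move=> [a0 b0]; apply: x0; rewrite a0 b0.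
  case: (ltgtP b 0) => ? h; [constructor 3|constructor 1|]; try lia.
  by case: (ltgtP a 0) => ?; [constructor 3|constructor 2|]; lia.
have U1 : unitO d (-1, 0) by apply: U; rewrite normOZ.
case=> h; [exists oneO|exists oneO|exists (-1, 0)]; split => //;
  rewrite ?mulOZ ?(normOZ d 1) //=; try exact: unitO1; lia.
Qed.

Lemma sector_unique d x u : d \in class_one -> unitO d u ->
  in_sector d x -> in_sector d (mulO d u x) -> u = oneO.
Proof.
move=> hd /(unitOP u hd) N1; have N4 := mulr4_normO d u.
move: N1 N4; rewrite normOE; case: x u => a b [s t] /= N1 N4.
suff : in_sector d (a, b) -> in_sector d (mulO d (s, t) (a, b)) -> s = 1 /\ t = 0.
  by move=> H h1 h2; have [-> ->] := H h1 h2.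
have [d1|d1] := eqVneq d (-1).
  have mE v : mulO d v (a, b) = (v.1 * a - v.2 * b, v.1 * b + v.2 * a).
    by rewrite d1 /mulO; congr pair; rewrite -?[wp _]/(0 : int) -?[wq _]/(-1 : int) /=; ring.
  rewrite mE /in_sector d1 eqxx orTb /=.
  move: N1 {N4 mE}; rewrite d1 -[wp _]/(0 : int) -[wq _]/(-1 : int) => N1.
  have [s1 s2] : -1 <= s /\ s <= 1 by split; nia.
  have [t1 t2] : -1 <= t /\ t <= 1 by split; nia.
  have : s = -1 \/ s = 0 \/ s = 1 by lia.
  have : t = -1 \/ t = 0 \/ t = 1 by lia.
  by move=> [|[]] tE [|[]] sE; rewrite tE sE in N1 *; lia.
have [d3|d3] := eqVneq d (-3).
  have mE v : mulO d v (a, b) = (v.1 * a - v.2 * b, v.1 * b + v.2 * a + v.2 * b).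
    by rewrite d3 /mulO; congr pair; rewrite -?[wp _]/(1 : int) -?[wq _]/(-1 : int) /=; ring.
  rewrite mE /in_sector d3 eqxx orbT /=.
  move: N1 {N4 mE}; rewrite d3 -[wp _]/(1 : int) -[wq _]/(-1 : int) => N1.
  have [s1 s2] : -1 <= s /\ s <= 1 by split; nia.
  have [t1 t2] : -1 <= t /\ t <= 1 by split; nia.
  have : s = -1 \/ s = 0 \/ s = 1 by lia.
  have : t = -1 \/ t = 0 \/ t = 1 by lia.
  by move=> [|[]] tE [|[]] sE; rewrite tE sE in N1 *; lia.
rewrite /in_sector (negbTE d1) (negbTE d3) /=.
have D4 : 4 < abs_disc d.
  by move: d1 d3; have [] := class_oneP hd => -[] ->.
(* From 4 = (2 s + p t)^2 + D t^2 with D > 4; hence 1 and -1 are the only units. *)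
have t0 : t = 0.
  move: N4; rewrite N1; have := sqr_ge0 (2 * s + wp d * t).
  move: (_ + wp d * t) (abs_disc d) D4 => r D D4 r0 E.
  have [//|tn] := eqVneq t 0.
  have : 1 <= t ^+ 2 by move: tn; nia.
  by move: r0 E; move: (r ^+ 2) (t ^+ 2) => r2 t2; nia.
have s1 : s = 1 \/ s = -1.
  move: N1; rewrite t0; nia.
rewrite t0; case: s1 => -> //; lia.
Qed.

(** * Unitary divisors *)

Lemma in_sector_neq0 d x : in_sector d x -> x <> zeroO.
Proof. by move=> + x0; rewrite x0 /in_sector; case: ifP. Qed.

Lemma in_sector1 d : in_sector d oneO.
Proof. by rewrite /in_sector; case: ifP. Qed.

Lemma sector_assoc d x y : d \in class_one -> in_sector d x -> in_sector d y ->
  dvdO d x y -> dvdO d y x -> x = y.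
Proof.
move=> hd xS yS [s yE] [t xE]; have x0 := in_sector_neq0 xS.
have st : unitO d s.
  by exists t; apply: (mulOI hd x0); rewrite mulO1 mulOA -yE -xE.
rewrite yE mulOC in yS *; by rewrite (sector_unique hd st xS yS) mul1O.
Qed.

(** Turns the sector associate into a function, whose value at 0 is unconstrained. *)
Lemma sector_rep d : d \in class_one -> exists rep : OK -> OK,
  forall x, x <> zeroO -> in_sector d (rep x) /\
    exists2 u, unitO d u & rep x = mulO d u x.
Proof.
move=> hd; pose P x r := x <> zeroO ->
  in_sector d r /\ exists2 u, unitO d u & r = mulO d u x.
suff /choice[rep repP] : forall x, exists r, P x r by exists rep.
move=> x; rewrite /P; have [->|x0] := pselect (x = zeroO); first by exists zeroO.
have [u [uU uS]] := sector_exists hd x0; exists (mulO d u x) => _.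
by split=> //; exists u.
Qed.

Definition unitary_divisor d x z : Prop :=
  in_sector d x /\ exists y, z = mulO d x y /\ coprimeO d x y.

Lemma diamondP (R : realType) d x z : d \in class_one ->
  diamond R d x z <-> unitary_divisor d x z.
Proof. by move=> hd; split=> -[xA ?]; split=> //; move: xA; rewrite inAP. Qed.

Lemma unitary_divisor1 d z : unitary_divisor d oneO z.
Proof.
split; first exact: in_sector1.
by exists z; rewrite mul1O; split=> //; apply: coprime1O.
Qed.

(** Here [w] is the sector associate of x y, with cofactor a unit times x' y'. Coprimality reduces
    to four pairs: two are given, and the mixed ones come from [co]. *)
Lemma unitary_divisor_mul d a b x y w : d \in class_one ->
  a <> zeroO -> b <> zeroO -> coprimeO d a b ->
  unitary_divisor d x a -> unitary_divisor d y b ->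
  in_sector d w -> dvdO d w (mulO d x y) -> dvdO d (mulO d x y) w ->
  unitary_divisor d w (mulO d a b).
Proof.
move=> hd a0 b0 co [xS [x' [aE xx']]] [yS [y' [bE yy']]] wS wxy [t wE].
split=> //; have [s xyE] := wxy.
exists (mulO d s (mulO d x' y')); rewrite mulOA -xyE; split.
  by rewrite aE bE mulOACA.
have x0 := in_sector_neq0 xS; have y0 := in_sector_neq0 yS.
have x'0 : x' <> zeroO by move=> e; apply: a0; rewrite aE e mulO0.
have y'0 : y' <> zeroO by move=> e; apply: b0; rewrite bE e mulO0.
have xa : dvdO d x a by rewrite aE; apply: dvdO_mulr.
have x'a : dvdO d x' a by rewrite aE; apply: dvdO_mull.
have yb : dvdO d y b by rewrite bE; apply: dvdO_mulr.
have y'b : dvdO d y' b by rewrite bE; apply: dvdO_mull.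
have sU : unitO d s.
  exists t; apply: (mulOI hd (in_sector_neq0 wS)).
  by rewrite mulO1 mulOA -xyE -wE.
have H : coprimeO d (mulO d x y) (mulO d x' y').
  apply: coprimeOM => //; apply: coprimeO_sym; apply: coprimeOM => //.
  - exact: coprimeO_sym.
  - exact: coprimeO_dvd x'a yb co.
  - by apply: coprimeO_sym; apply: coprimeO_dvd xa y'b co.
  - exact: coprimeO_sym.
apply: coprimeO_dvd H => //; case: sU => r sr.
by exists r; rewrite mulOAC sr mul1O.
Qed.

Lemma unitary_divisor_unit d x u g a b : in_sector d x -> unitO d u ->
  x = mulO d u g -> a = mulO d g b -> coprimeO d g b -> unitary_divisor d x a.
Proof.
move=> xS [r ur] xE aE co; split=> //; exists (mulO d r b); split.
  by rewrite xE aE mulOACA ur mul1O.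
apply: coprimeO_dvd co.
  by exists r; rewrite xE mulOAC ur mul1O.
by exists u; rewrite mulOAC (mulOC d r) ur mul1O.
Qed.

(** Let g = gcd(w, a), w = g w', a = g a'. Cancelling g in a b = w v leaves a' b = w' v, so w' | b
    by Gauss, b = w' b' and v = a' b'. The parts are g and w' up to units. *)
Lemma unitary_divisor_split d a b w : d \in class_one ->
  a <> zeroO -> b <> zeroO -> coprimeO d a b ->
  unitary_divisor d w (mulO d a b) ->
  exists x y, [/\ unitary_divisor d x a, unitary_divisor d y b,
    dvdO d w (mulO d x y) & dvdO d (mulO d x y) w].
Proof.
move=> hd a0 b0 co [wS [v [abE wv]]].
have [rep repP] := sector_rep hd.
have [g [w' [a' [wE aE co']]]] := gcdO_decomp w hd a0.
have g0 : g <> zeroO by move=> e; apply: a0; rewrite aE e mul0O.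
have a'0 : a' <> zeroO by move=> e; apply: a0; rewrite aE e mulO0.
have w'0 : w' <> zeroO.
  by move=> e; apply: (in_sector_neq0 wS); rewrite wE e mulO0.
have E : mulO d a' b = mulO d w' v.
  by apply: (mulOI hd g0); rewrite !mulOA -aE -wE.
have [b' bE] : dvdO d w' b by apply: (gaussO hd a'0 co'); rewrite E; apply: dvdO_mulr.
have vE : v = mulO d a' b'.
  by apply: (mulOI hd w'0); rewrite -E bE mulOCA.
have [gS [u uU uE]] := repP _ g0.
have [wS' [t tU tE]] := repP _ w'0.
have gw : dvdO d g w by rewrite wE; apply: dvdO_mulr.
have w'w : dvdO d w' w by rewrite wE; apply: dvdO_mull.
have a'v : dvdO d a' v by rewrite vE; apply: dvdO_mulr.
have b'v : dvdO d b' v by rewrite vE; apply: dvdO_mull.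
have E2 : mulO d (rep g) (rep w') = mulO d (mulO d u t) w.
  by rewrite uE tE mulOACA -wE.
exists (rep g), (rep w'); split.
- by apply: unitary_divisor_unit uU uE aE (coprimeO_dvd gw a'v wv).
- by apply: unitary_divisor_unit tU tE bE (coprimeO_dvd w'w b'v wv).
- by rewrite E2; apply: dvdO_mull.
case: uU tU => [u' uu'] [t' tt']; exists (mulO d u' t').
by rewrite E2 mulOAC mulOACA uu' tt' !mul1O.
Qed.

(** Strong induction on the norm: [z] is a unit, or has no factorization into coprime nonunits, or
    splits and the two lists are multiplied. An abstract [f] covers both exponents. *)
Lemma unitary_divisor_enum (A : comPzRingType) (f : OK -> A) d z :
  d \in class_one -> {morph f : x y / mulO d x y >-> x * y} ->
  (forall u, unitO d u -> f u = 1) -> z <> zeroO ->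
  exists s qs : seq OK, [/\ uniq s, forall x, x \in s <-> unitary_divisor d x z,
    forall q, q \in qs -> q \in s /\ ~ unitO d q,
    \sum_(x <- s) f x = \prod_(q <- qs) (1 + f q) & f z = \prod_(q <- qs) f q].
Proof.
move=> hd fM fU; have [rep repP] := sector_rep hd.
have [k] := ubnP (absz (normO d z)); elim: k z => // k IH z zk z0.
have [zU|zU] := pselect (unitO d z).
  exists [:: oneO], [::]; split=> //.
  - move=> x; rewrite inE; split=> [/eqP ->|[xS [y [zE _]]]].
      exact: unitary_divisor1.
    have xU : unitO d x by apply: unitO_dvd zU; rewrite zE; apply: dvdO_mulr.
    apply/eqP; apply: (sector_unique (x := oneO) hd xU (in_sector1 d)).
    by rewrite mulO1.
  - by rewrite big_cons !big_nil addr0 fU //; apply: unitO1.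
  - by rewrite big_nil fU.
have [[a [b [zE co aU bU]]]|indec] := pselect (exists a b,
    [/\ z = mulO d a b, coprimeO d a b, ~ unitO d a & ~ unitO d b]); last first.
  have [zS [u uU uE]] := repP _ z0.
  have rzU : ~ unitO d (rep z).
    by rewrite uE => uzU; apply: zU; apply: unitO_dvd uzU; apply: dvdO_mull.
  (* In a coprime factorization of an indecomposable [z] one factor is a unit, which leaves 1 and
     the associate of [z]. *)
  exists [:: oneO; rep z], [:: rep z]; split=> //.
  - by rewrite /= inE andbT; apply/eqP => e; apply: rzU; rewrite -e; apply: unitO1.
  - move=> x; rewrite !inE; split=> [/orP[/eqP ->|/eqP ->]|[xS [y [zE xy]]]].
    + exact: unitary_divisor1.
    + apply: (@unitary_divisor_unit d (rep z) u z z oneO) => //.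
        by rewrite mulO1.
      by apply: coprimeO_sym; apply: coprime1O.
    + have [xU|xU] := pselect (unitO d x).
        apply/orP; left; apply/eqP.
        by apply: (sector_unique (x := oneO) hd xU (in_sector1 d)); rewrite mulO1.
      have [yU|yU] := pselect (unitO d y); last by case: indec; exists x, y.
      apply/orP; right; apply/eqP; apply: (sector_assoc hd xS zS).
        by rewrite uE zE mulOCA; apply: dvdO_mulr.
      case: uU yU => u' uu' [y' yy']; exists (mulO d u' y').
      by rewrite uE zE mulOACA uu' mul1O -mulOA yy' mulO1.
  - by move=> q; rewrite !inE => /eqP ->; rewrite eqxx orbT.
  - by rewrite !big_cons !big_nil addr0 mulr1 fU //; apply: unitO1.
  - by rewrite big_cons big_nil uE fM (fU u) // mul1r mulr1.
have a0 : a <> zeroO by move=> e; apply: z0; rewrite zE e mul0O.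
have b0 : b <> zeroO by move=> e; apply: z0; rewrite zE e mulO0.
have aN := normO_gt0 hd a0; have bN := normO_gt0 hd b0.
have a1 : normO d a <> 1 by move/(unitOP a hd).
have b1 : normO d b <> 1 by move/(unitOP b hd).
have := normOM d a b; rewrite -zE => zN.
have [sa [qa [sau saP qaP sumA prodA]]] : exists s qs : seq OK,
    [/\ uniq s, forall x, x \in s <-> unitary_divisor d x a,
    forall q, q \in qs -> q \in s /\ ~ unitO d q,
    \sum_(x <- s) f x = \prod_(q <- qs) (1 + f q) & f a = \prod_(q <- qs) f q].
  by apply: IH => //; nia.
have [sb [qb [sbu sbP qbP sumB prodB]]] : exists s qs : seq OK,
    [/\ uniq s, forall x, x \in s <-> unitary_divisor d x b,
    forall q, q \in qs -> q \in s /\ ~ unitO d q,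
    \sum_(x <- s) f x = \prod_(q <- qs) (1 + f q) & f b = \prod_(q <- qs) f q].
  by apply: IH => //; nia.
have dvda x : x \in sa -> x <> zeroO /\ dvdO d x a.
  move/saP => [/in_sector_neq0 ? [y [-> _]]]; by split=> //; apply: dvdO_mulr.
have dvdb x : x \in sb -> x <> zeroO /\ dvdO d x b.
  move/sbP => [/in_sector_neq0 ? [y [-> _]]]; by split=> //; apply: dvdO_mulr.
(* A product of sector elements may leave the sector, hence the normalisation, which [f] does not
   see. *)
pose m x y := rep (mulO d x y).
have mP x y : x \in sa -> y \in sb -> [/\ in_sector d (m x y),
    dvdO d (m x y) (mulO d x y), dvdO d (mulO d x y) (m x y) & f (m x y) = f x * f y].
  move=> /dvda[x0 _] /dvdb[y0 _].
  have [mS [u uU mE]] := repP _ (mulO_neq0 hd x0 y0).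
  rewrite -/(m x y) in mS mE; split=> //; last by rewrite mE !fM fU // mul1r.
    by case: uU => r ur; exists r; rewrite mE mulOAC ur mul1O.
  by exists u; rewrite mulOC.
(* Coprimality of a and b separates the two factors by Gauss; applied both ways, this makes them
   associate, hence equal in the sector. *)
have m_inj x1 y1 x2 y2 : x1 \in sa -> x2 \in sa -> y1 \in sb -> y2 \in sb ->
    m x1 y1 = m x2 y2 -> dvdO d x1 x2 /\ dvdO d y1 y2.
  move=> xa1 xa2 yb1 yb2 e.
  have [x10 x1a] := dvda _ xa1; have [x20 x2a] := dvda _ xa2.
  have [y10 y1b] := dvdb _ yb1; have [y20 y2b] := dvdb _ yb2.
  have D : dvdO d (mulO d x1 y1) (mulO d x2 y2).
    have [_ _ h _] := mP _ _ xa1 yb1; have [_ h' _ _] := mP _ _ xa2 yb2.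
    by apply: dvdO_trans h _; rewrite e.
  split.
    apply: (gaussO hd y20); first exact: coprimeO_dvd x1a y2b co.
    by rewrite mulOC; apply: dvdO_trans D; apply: dvdO_mulr.
  apply: (gaussO hd x20); first by apply: coprimeO_sym; apply: coprimeO_dvd x2a y1b co.
  by apply: dvdO_trans D; apply: dvdO_mull.
(* Pairing with 1 embeds both lists into the list of products, so the factors remain among the
   divisors of [z]. *)
have ma x : x \in sa -> m x oneO = x.
  move=> xa; have b1b : oneO \in sb by apply/sbP; apply: unitary_divisor1.
  have [mS h1 h2 _] := mP _ _ xa b1b; rewrite mulO1 in h1 h2.
  by apply: (sector_assoc hd) => //; case/saP: xa.
have mb y : y \in sb -> m oneO y = y.
  move=> yb; have a1a : oneO \in sa by apply/saP; apply: unitary_divisor1.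
  have [mS h1 h2 _] := mP _ _ a1a yb; rewrite mul1O in h1 h2.
  by apply: (sector_assoc hd) => //; case/sbP: yb.
exists [seq m x y | x <- sa, y <- sb], (qa ++ qb); split.
- apply: allpairs_uniq => // -[x1 y1] [x2 y2] /allpairsP[[? ?] /= [xa1 yb1 [-> ->]]].
  move=> /allpairsP[[? ?] /= [xa2 yb2 [-> ->]]] e.
  have [h1 h2] := m_inj _ _ _ _ xa1 xa2 yb1 yb2 e.
  have [h3 h4] := m_inj _ _ _ _ xa2 xa1 yb2 yb1 (esym e).
  congr pair; apply: (sector_assoc hd) => //;
    by [case/saP: xa1 | case/saP: xa2 | case/sbP: yb1 | case/sbP: yb2].
- move=> w; rewrite zE; split.
    case/allpairsP => -[x y] /= [xa yb ->].
    have [mS h1 h2 _] := mP _ _ xa yb.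
    by apply: (unitary_divisor_mul hd a0 b0 co) h1 h2 => //; [apply/saP|apply/sbP].
  move=> wz; have [x [y [/saP xa /sbP yb h1 h2]]] := unitary_divisor_split hd a0 b0 co wz.
  have [mS h3 h4 _] := mP _ _ xa yb.
  apply/allpairsP; exists (x, y); split=> //=.
  by apply: (sector_assoc hd) => //; [case: wz | apply: dvdO_trans h4 | apply: dvdO_trans h2].
- move=> q; rewrite mem_cat => /orP[/qaP[qs qU]|/qbP[qs qU]]; split=> //.
    apply/allpairsP; exists (q, oneO); rewrite ma //; split=> //=.
    by apply/sbP; apply: unitary_divisor1.
  apply/allpairsP; exists (oneO, q); rewrite mb //; split=> //=.
  by apply/saP; apply: unitary_divisor1.
- rewrite big_allpairs_dep big_cat /= -sumA -sumB big_distrl /=.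
  rewrite big_seq [RHS]big_seq; apply: eq_bigr => x xa.
  rewrite big_distrr /= big_seq [RHS]big_seq; apply: eq_bigr => y yb.
  by have [_ _ _ ->] := mP _ _ xa yb.
- by rewrite zE fM prodA prodB big_cat.
Qed.

(** * Integrality of absolute values and the parity contradiction *)

Lemma absOM (R : realType) d : d \in class_one ->
  {morph absO R d : x y / mulO d x y >-> x * y}.
Proof. by move=> hd x y; rewrite /absO normOM rmorphM sqrtrM // ler0z normO_ge0. Qed.

(* Multiplying sum |x| = t |z| by |z| makes the right-hand side rational, while
   each |x| |z| is the square root of an integer; the divisor x = 1 then shows
   that |z| itself is rational. *)
Lemma abs_unitary_divisor_nat (R : realType) d z (s : seq OK) (t : nat) :
  d \in class_one -> z <> zeroO ->
  (forall x, x \in s <-> unitary_divisor d x z) ->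
  \sum_(x <- s) absO R d x = t%:R * absO R d z ->
  forall x, x \in s -> exists k : nat, absO R d x = k%:R.
Proof.
move=> hd z0 sP E; pose K (r : R) := exists q : rat, r = ratr q.
have Ks : subfield K := subfield_rat R.
have Kint (n : int) : K n%:~R by exists n%:~R; rewrite ratr_int.
have Kz x : x \in s -> K (absO R d x * absO R d z).
  move=> xs; apply: (positive_sqrt_sum (l := [seq absO R d x * absO R d z | x <- s]) Ks).
  - move=> _ /mapP[y /sP[/in_sector_neq0 y0 _] ->].
    by rewrite mulr_gt0 ?absO_gt0 // exprMn !absO_sqr // -rmorphM; split=> //; apply: Kint.
  - rewrite big_map -mulr_suml E -mulrA -expr2 absO_sqr //.
    by apply: subfieldM; [exact: Ks | exact: (Kint t) | exact: Kint].
  - exact: map_f.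
have s1 : oneO \in s by apply/sP; apply: unitary_divisor1.
have Kabs : K (absO R d z).
  by have := Kz _ s1; rewrite {1}/absO normO1 sqrtr1 mul1r.
have az := absO_gt0 R hd z0.
move=> x xs; have [_ _ KV] := Ks.
have [q qE] : K (absO R d x).
  by rewrite -[absO R d x](mulfK (lt0r_neq0 az)); apply: KV => //; apply: Kz.
have q0 : 0 <= q by rewrite -(ler0q R) -qE sqrtr_ge0.
have [m mE] : exists m : nat, normO d x = m%:Z.
  by exists `|normO d x|%N; rewrite gez0_abs // normO_ge0.
have q2 : q ^+ 2 = m%:R.
  by apply: (fmorph_inj (ratr : rat -> R)); rewrite rmorphXn /= -qE absO_sqr // mE ratr_nat.
by have [k kE] := rat_sqrt_nat q0 q2; exists k; rewrite qE kE ratr_nat.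
Qed.

Theorem theorem2p2 (R : realType) (d : int) (z : OK) (n t : nat) :
  d \in [:: -163; -67; -43; -19; -11; -7; -3; -2; -1] ->
  z <> zeroO ->
  (n == 1)%N || (n == 2)%N ->
  t != 1%N ->
  I_star R d n z = t%:R ->
  (2 %| normO d z)%Z.
Proof.
move=> hd z0 hn ht It; have [//|Nodd] := boolP (2 %| normO d z)%Z.
case/eqP: ht; pose f x : R := absO R d x ^+ n.
have fM : {morph f : x y / mulO d x y >-> x * y}.
  by move=> x y; rewrite /f absOM // exprMn.
have fU u : unitO d u -> f u = 1.
  by move=> /(unitOP u hd) N1; rewrite /f /absO N1 sqrtr1 expr1n.
have fz0 : f z != 0 by rewrite expf_neq0 // gt_eqF // absO_gt0.
have [s [qs [us sP qsP sumE prodE]]] := unitary_divisor_enum hd fM fU z0.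
have sumf : \sum_(x <- s) f x = t%:R * f z.
  rewrite -It /I_star divfK // /delta_star fsbig_seq //; apply: eq_fsbigl.
  by apply/seteqP; split=> x /=; [move/sP/(diamondP R x z hd) | move/(diamondP R x z hd)/sP].
have f_nat x : x \in s -> exists k : nat, f x = k%:R.
  case/orP: hn => /eqP nE; rewrite /f nE in sumf *.
    have sum1 : \sum_(x <- s) absO R d x = t%:R * absO R d z.
      by rewrite -[absO R d z]expr1 -sumf; apply: eq_bigr => y _; rewrite expr1.
    by rewrite expr1; apply: abs_unitary_divisor_nat sum1 x.
  exists `|normO d x|%N; rewrite absO_sqr //.
  by rewrite -[in LHS](gez0_abs (normO_ge0 x hd)).
(* Only values on [s] matter; 0 is a default elsewhere. *)
have /choice[k kP] : forall q, exists k : nat, q \in s -> f q = k%:R.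
  by move=> q; have [/f_nat[k ->]|_] := boolP (q \in s); [exists k | exists 0%N].
apply: (@prod_succ_odd _ qs k t).
  move=> q /qsP[qs0 qU]; have fq := kP _ qs0.
  have [qS [y [zE _]]] : unitary_divisor d q z by apply/sP.
  have q0 := normO_gt0 hd (in_sector_neq0 qS).
  have q1 : normO d q <> 1 by move/(unitOP q hd).
  have qodd : ~~ (2 %| normO d q)%Z.
    by apply: contra Nodd; rewrite zE normOM => /dvdz_mulr.
  (* The relation k^2 = N(q)^n treats both exponents alike and passes oddness and the bound > 1 from
     the norm to k. *)
  have kE : (k q ^ 2)%N%:Z = normO d q ^+ n.
    apply: (@intr_inj R); rewrite rmorphXn /= -absO_sqr // -exprM mulnC exprM.
    by rewrite -[_ ^+ n]/(f q) fq -natrX.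
  have {}kE : (k q ^ 2 = `|normO d q| ^ n)%N by rewrite -abszX -kE.
  have n0 : (0 < n)%N by case/orP: hn => /eqP ->.
  have m1 : (1 < `|normO d q|)%N by lia.
  have mo : odd `|normO d q| by move: qodd; rewrite dvdzE dvdn2 negbK.
  have -> : odd (k q) by move/(congr1 odd): kE; rewrite !oddX mo orbT.
  by rewrite /= -(@ltn_exp2r 1 _ 2) // exp1n kE -(exp1n n) ltn_exp2r.
apply/eqP; rewrite -(eqr_nat R) natrM !natr_prod; apply/eqP.
have kR q : q \in qs -> f q = (k q)%:R by move=> /qsP[/kP].
have E1 : \prod_(q <- qs) (1 + f q) = \prod_(q <- qs) (1 + k q)%:R.
  by apply: eq_big_seq => q /kR ->; rewrite natrD.
have E2 : \prod_(q <- qs) f q = \prod_(q <- qs) (k q)%:R.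
  by apply: eq_big_seq => q /kR.
by rewrite -E1 -E2 -sumE sumf prodE.
Qed.
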